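(* For any integer $k\ge 1$, $$S(k+1,k)=\sum_{i=1}^{k}(2^i-1)=2^{k+1}-k-2,$$ i.e. on $Q^{k+1}$ with the $k$-move rule the even solvability property is achieved with $k+2$ labeled tokens.
   Context: Let $d\ge 1$, $1\le k\le d$, $1\le l\le 2^d$ be integers. $Q^d$ is the graph of vertices and edges of the $d$-dimensional cube, with vertex set $\{0,1\}^d$. A $k$-dimensional face ($k$-face) of $Q^d$ is a set of $2^k$ vertices obtained by fixing $d-k$ of the coordinates. $\mathcal{C}[d,l]$ is the set of all configurations of $2^d-l$ tokens, labeled $1,\dots,2^d-l$, placed on distinct vertices of $Q^d$ (so $l$ vertices are unoccupied). Moves: if a token $t$ sits at a vertex of a $k$-face $\sigma$ and all remaining vertices of $\sigma$ are unoccupied, then $t$ can be moved to any other vertex of $\sigma$; this is called a $k$-move. The puzzle graph $puz[d,k,l]$ has vertex set $\mathcal{C}[d,l]$, with $C$ and $D$ joined by an edge when one is reached from the other by a single $k$-move. A configuration is obtained from $C$ by a permutation $g$ if it has the same occupied vertices and the labels are permuted by $g$. $puz[d,k,l]$ has the even solvability property if there is a configuration $C\in\mathcal C[d,l]$ such that all configurations obtained from $C$ by an even permutation of the labels lie in the same connected component of $puz[d,k,l]$ as $C$. $S(d,k)$ is the minimum integer $l$ such that $puz[d,k,l]$ has the even solvability property. *)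

(* Defs.v *)
From HB Require Import structures.
From mathcomp Require Import all_boot all_fingroup.

Set Implicit Arguments.
Unset Strict Implicit.
Unset Printing Implicit Defensive.

Notation vertex d := {ffun 'I_d -> bool}.

(* The coordinates outside [A] are free, so the face has 2 ^ (d - #|A|)
   vertices. *)
Definition face d (A : {set 'I_d}) (v : vertex d) : {set vertex d} :=
  [set x : vertex d | [forall i in A, x i == v i]].

Definition is_face d (k : nat) (sigma : {set vertex d}) : bool :=
  [exists A : {set 'I_d}, exists v : vertex d,
     (#|A| + k == d) && (sigma == face A v)].

(* Tokens are labeled by 'I_(2 ^ d - l); a configuration maps each token to
   the vertex it occupies. *)
Definition config (d l : nat) : Type :=
  {c : {ffun 'I_(2 ^ d - l) -> vertex d} | injectiveb c}.

HB.instance Definition _ d l := SubFinite.on (config d l).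

Definition occupied d l (C : config d l) : {set vertex d} :=
  [set val C t | t : 'I_(2 ^ d - l)].

Definition kmove d k l (C D : config d l) : bool :=
  [exists sigma : {set vertex d}, exists t : 'I_(2 ^ d - l),
    [&& is_face k sigma,
        val C t \in sigma,
        [forall x in sigma, (x != val C t) ==> (x \notin occupied C)],
        val D t \in sigma,
        val D t != val C t &
        [forall s, (s != t) ==> (val D s == val C s)]]].

Definition puz d k l : rel (config d l) :=
  fun C D => kmove k C D || kmove k D C.

(* [D] carries the label [g t] where [C] carries the label [t]; in particular
   both have the same occupied vertices. *)
Definition permuted_by d l (g : {perm 'I_(2 ^ d - l)}) (C D : config d l) :
  bool := [forall t, val D (g t) == val C t].

Definition even_solvable (d k l : nat) : bool :=
  [exists C : config d l, forall g : {perm 'I_(2 ^ d - l)},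
    ~~ odd_perm g ==>
      [forall D : config d l, permuted_by g C D ==> connect (@puz d k l) C D]].

Lemma even_solvable_ex d k :
  exists l, (1 <= l <= 2 ^ d) && even_solvable d k l.
Proof.
exists (2 ^ d); rewrite leqnn expn_gt0 /=.
have no (t : 'I_(2 ^ d - 2 ^ d)) : False by case: t; rewrite subnn.
pose c : {ffun 'I_(2 ^ d - 2 ^ d) -> vertex d} := [ffun=> [ffun=> false]].
have ci : injectiveb c by apply/injectiveP => t; case: (no t).
apply/existsP; exists (exist _ c ci : config d (2 ^ d)).
apply/forallP => g; apply/implyP => _; apply/forallP => D; apply/implyP => _.
suff -> : D = exist _ c ci by exact: connect0.
by apply: val_inj; apply/ffunP => t; case: (no t).
Qed.

(* The least number [l] of unoccupied vertices, 1 <= l <= 2 ^ d, with the even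
   solvability property; it exists because [l = 2 ^ d] always has it. *)
Definition min_even_solvable (d k : nat) : nat := ex_minn (even_solvable_ex d k).

(* Main.v *)
Require Import Defs.
From mathcomp Require Import all_boot all_fingroup.

Set Implicit Arguments.
Unset Strict Implicit.
Unset Printing Implicit Defensive.

(** Write [d = k + 1].  A [k]-move uses a facet [x_i = b], so token [t] can move
    exactly when it is the only token with its value in some coordinate [i].

    With at least [d + 2] tokens, some set [M] of at least two tokens is never
    split by a coordinate into one token and the rest: take [M] minimal with
    [#|M|] at least 2 plus the number of coordinates nonconstant on [M].
    Tokens of such an [M] never move.

    With [d + 1] tokens, place them on a vertex [a] and its [d] neighbours.
    Moving every token other than those at [a] and [a + e_j] in direction [j]
    gives the star centred at [a + e_j], in which the labels of the centre and
    of the [j]-th leaf have been exchanged.  If [u] and [v] are two such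
    transpositions, [u v u v] brings the star back to [a], and it is the
    3-cycle [v u]; so every product of an even number of them is realised. *)

(** * Moves across facets of the cube *)

Lemma config_inj d l (C : config d l) : injective (val C).
Proof. by apply/injectiveP; exact: (valP C). Qed.

Lemma injectiveb_finfun d l (f : 'I_(2 ^ d - l) -> vertex d) :
  injective f -> injectiveb [ffun t => f t].
Proof. by move=> f_inj; apply/injectiveP => s t; rewrite !ffunE => /f_inj. Qed.

Definition config_of d l (f : 'I_(2 ^ d - l) -> vertex d) (f_inj : injective f) :
  config d l :=
  exist (fun c : {ffun 'I_(2 ^ d - l) -> vertex d} => injectiveb c)
    _ (injectiveb_finfun f_inj).

Lemma config_ofE d l f (f_inj : injective f) t : val (@config_of d l f f_inj) t = f t.
Proof. by rewrite /= ffunE. Qed.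

Lemma face1E d (i : 'I_d) (v x : vertex d) : (x \in face [set i] v) = (x i == v i).
Proof.
rewrite inE; apply/forall_inP/idP => [/(_ i)|xv j]; first by rewrite inE eqxx => ->.
by rewrite inE => /eqP ->.
Qed.

(** A [k]-face of the [k.+1]-cube fixes exactly one coordinate [i], so it holds no token besides [t]
    exactly when every other token differs from [t] at [i]. *)
Lemma kmoveP k l (C D : config k.+1 l) :
  reflect (exists t i, [/\ val D t != val C t, val D t i = val C t i &
             forall s, s != t -> val D s = val C s /\ val C s i != val C t i])
          (kmove k C D).
Proof.
apply: (iffP existsP) => [[sigma /existsP[t /and5P[sigmaF Ct alone Dt]]]|].
  case/andP=> DCt /forallP others; move: sigmaF => /existsP[A /existsP[v]].
  case/andP=> cardA /eqP sigmaE.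
  have /cards1P[i Ai] : #|A| == 1 by rewrite -(eqn_add2r k).
  rewrite {sigma}sigmaE {A cardA}Ai in alone Ct Dt.
  move: Ct Dt; rewrite !face1E => /eqP Ct /eqP Dt.
  exists t, i; split; rewrite ?Ct ?Dt // => s st.
  split; first by apply/eqP; exact: (implyP (others s)).
  apply/negP => Csi; move: alone => /forall_inP/(_ (val C s)).
  by rewrite face1E Csi (inj_eq (@config_inj _ _ C)) st imset_f // => /(_ isT).
case=> t [i [DCt Dti others]].
exists (face [set i] (val C t)); apply/existsP; exists t.
rewrite !face1E Dti eqxx DCt /=; apply/and3P; split.
- apply/existsP; exists [set i]; apply/existsP; exists (val C t).
  by rewrite cards1 add1n !eqxx.
- apply/forall_inP => x; rewrite face1E => xi; apply/implyP => xt.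
  apply/imsetP => -[s _ xs]; rewrite xs in xi xt.
  have st : s != t by apply: contraNneq xt => ->.
  by case: (others s st) => _; rewrite xi.
- by apply/forallP => s; apply/implyP => /others[-> _].
Qed.

Lemma kmove_sym k l (C D : config k.+1 l) : kmove k C D = kmove k D C.
Proof.
suff sub (X Y : config k.+1 l) : kmove k X Y -> kmove k Y X by apply/idP/idP; exact: sub.
case/kmoveP=> t [i [DCt Dti others]]; apply/kmoveP; exists t, i.
split; rewrite 1?eq_sym // => s /others[-> Cs]; split=> //.
by rewrite Dti.
Qed.

(** * Words in the transpositions that move a fixed point *)

(** Each side is a conjugate, and both equal the transposition of [x] and [y]. *)
Lemma tperm_braid (T : finType) (x y z : T) : x != z -> y != z -> x != y ->
  (tperm z x * tperm z y * tperm z x = tperm z y * tperm z x * tperm z y)%g.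
Proof.
move=> xz yz xy; rewrite -{1}(tpermV z x) -{2}(tpermV z y) -!mulgA -!conjgE !tpermJ.
have [zx zy] : z != x /\ z != y by rewrite !(eq_sym z).
by rewrite !tpermL (tpermD zy) // (tpermD zx) ?(eq_sym y) // tpermC.
Qed.

(** A transposition of [x] and [y] that avoids [z] is the conjugate of [tperm z y] by [tperm z x],
    hence a word of three letters. *)
Lemma perm_star_word (T : finType) (z : T) (s : {perm T}) :
  exists2 w, all (predC1 z) w & s = (\prod_(x <- w) tperm z x)%g.
Proof.
have [ts -> {s}] := prod_tpermP s.
elim: ts => [|[x y] ts IHts] /=; first by exists [::]; rewrite ?big_nil.
rewrite /dpair /= big_cons => /andP[xy /IHts[w wz ->]] /=.
have [xz|xz] := eqVneq x z.
  by rewrite xz in xy *; exists (y :: w); rewrite ?big_cons //= eq_sym xy.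
have [->|yz] := eqVneq y z.
  by exists (x :: w); rewrite ?big_cons /= ?xz // tpermC.
exists [:: x, y, x & w]; first by rewrite /= xz yz.
rewrite !big_cons !mulgA; congr (_ * _)%g.
rewrite -{1}(tpermV z x) -mulgA -conjgE tpermJ tpermL tpermD //.
by rewrite eq_sym.
Qed.

Lemma odd_star_word (T : finType) (z : T) (w : seq T) :
  all (predC1 z) w -> odd_perm (\prod_(x <- w) tperm z x)%g = odd (size w).
Proof.
elim: w => [_|x w IHw /= /andP[xz /IHw w_odd]]; first by rewrite big_nil odd_perm1.
by rewrite big_cons odd_permM w_odd odd_tperm eq_sym xz.
Qed.

(** * Lower bound: immovable sets of tokens *)

Section LowerBound.

Variables (k l : nat).
Implicit Types (C D : config k.+1 l) (M : {set 'I_(2 ^ k.+1 - l)}).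

Definition rigid C M :=
  forall t i, t \in M -> exists s, [/\ s \in M, s != t & val C s i = val C t i].

(** A mover must be alone at some coordinate, so no member of [M] moves; hence rigidity persists
    along a path. *)
Lemma rigid_connect C D M :
  rigid C M -> connect (@puz k.+1 k l) C D -> {in M, val D =1 val C}.
Proof.
move=> + /connectP[p]; elim: p C => [|E p IHp] C rigC /=; first by move=> _ ->.
rewrite {1}/puz (kmove_sym E) orbb => /andP[/kmoveP[t [i [_ _ others]]] Ep] Dp.
have eqE s : s \in M -> val E s = val C s.
  move=> sM; have [st|/others[]//] := eqVneq s t.
  rewrite st in sM; have [u [uM ut Cu]] := rigC t i sM.
  by have [_] := others u ut; rewrite Cu eqxx.
have rigE : rigid E M.
  move=> s j sM; have [u [uM us Cu]] := rigC s j sM.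
  by exists u; rewrite !eqE.
by move=> s sM; rewrite (IHp _ rigE Ep Dp) // eqE.
Qed.

(** If [t] were alone in [M] at coordinate [i], deleting [t] would lose one token but also make [i]
    constant, so the inequality [P] would survive, against minimality. *)
Lemma rigid_exists C :
  k.+3 <= 2 ^ k.+1 - l -> exists2 M, rigid C M & M != set0.
Proof.
move=> ntok.
pose split M := [set i | [exists s in M, exists t in M, val C s i != val C t i]].
pose P M := #|split M| + 2 <= #|M|.
have PT : P setT.
  rewrite /P cardsT card_ord; apply: leq_trans ntok.
  by rewrite addn2 !ltnS -[leqRHS]card_ord max_card.
case: (arg_minnP (fun M => #|M|) PT) => M PM minM; exists M; last first.
  by rewrite -card_gt0; apply: leq_trans PM; rewrite addn2.
move=> t i tM.
have [/exists_inP[s sM /andP[st /eqP Cs]]|] :=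
  boolP [exists s in M, (s != t) && (val C s i == val C t i)].
  by exists s.
move/exists_inPn => alone; exfalso.
have other s : s \in M :\ t -> val C s i = ~~ val C t i.
  rewrite !inE => /andP[st /alone]; rewrite st.
  by case: (val C s i); case: (val C t i).
have M't : (#|M :\ t|).+1 = #|M| by rewrite (cardsD1 t M) tM.
suff PM' : P (M :\ t) by have := minM _ PM'; rewrite -M't ltnn.
rewrite /P -ltnS M't; apply: leq_trans (PM); rewrite -addSn leq_add2r.
(* The 2 in [P] leaves another token in [M], so [i] does vary on [M]. *)
have iM : i \in split M.
  have /card_gt0P[s sM'] : 0 < #|M :\ t|.
    by rewrite -ltnS M't; apply: leq_trans PM; rewrite addn2.
  rewrite inE; apply/exists_inP; exists s; first by case/setD1P: sM'.
  by apply/exists_inP; exists t; rewrite // other //; case: (val C t i).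
rewrite (cardsD1 i (split M)) iM ltnS; apply/subset_leq_card/subsetP => j.
rewrite inE => /exists_inP[s sM' /exists_inP[u uM' Csu]].
rewrite in_setD1; apply/andP; split.
  by apply: contraNneq Csu => ->; rewrite (other s) // (other u).
rewrite inE; apply/exists_inP; exists s; first by case/setD1P: sM'.
by apply/exists_inP; exists u => //; case/setD1P: uM'.
Qed.

Lemma not_even_solvable : k.+3 <= 2 ^ k.+1 - l -> ~~ even_solvable k.+1 k l.
Proof.
move=> ntok; apply/existsPn => C; apply/forallPn.
have [M rigC /set0Pn[t tM]] := rigid_exists C ntok.
have : 1 < #|[set~ t]|.
  by rewrite cardsC1 card_ord -ltnS prednK; apply: leq_trans ntok.
case/card_gt1P=> u [v []]; rewrite !inE => ut vt uv.
(* A 3-cycle is even and displaces the immovable token [t]. *)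
pose g : {perm 'I_(2 ^ k.+1 - l)} := (tperm t u * tperm t v)%g; exists g.
have Cg_inj : injective (fun s => val C (g^-1%g s)) by move=> s w /config_inj/perm_inj.
pose D := config_of Cg_inj.
rewrite odd_permM !odd_tperm (eq_sym t u) (eq_sym t v) ut vt /=.
apply/forallPn; exists D; rewrite negb_imply; apply/andP; split.
  by apply/forallP => s; rewrite config_ofE permK.
apply/negP => /(rigid_connect rigC) /(_ t tM); rewrite config_ofE => /config_inj gt.
have := permKV g t; rewrite gt permM tpermL tpermD 1?eq_sym // => ut_eq.
by rewrite ut_eq eqxx in ut.
Qed.

End LowerBound.

(** * Upper bound: permuting the tokens of a star *)

(** Coordinate [i] separates [t] from the start and the goal of every other token, so [t] can move
    whichever others have already moved; the moves are made one by one. *)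
Lemma connect_disjoint_moves k l (C D : config k.+1 l) :
  (forall t, val D t != val C t -> exists2 i, val D t i = val C t i &
     forall s, s != t -> val C s i != val C t i /\ val D s i != val C t i) ->
  connect (@puz k.+1 k l) C D.
Proof.
have [n] := ubnP #|[set t | val D t != val C t]|.
elim: n C => // n IHn C; rewrite ltnS => leCn movable.
have [/existsP[t DCt]|/existsPn CD] := boolP [exists t, val D t != val C t]; last first.
  suff -> : C = D by exact: connect0.
  by apply: val_inj; apply/ffunP => t; apply/esym/eqP; rewrite -[_ == _]negbK.
have [i Dti others] := movable t DCt.
pose e s := if s == t then val D t else val C s.
have e_inj : injective e.
  have sep s : s != t -> val C s <> val D t.
    by move=> /others[/eqP Cs _] CD; apply: Cs; rewrite CD.
  rewrite /e => s u; have [->|st] := eqVneq s t; have [->|ut] := eqVneq u t => //.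
  - by move/esym/(sep u ut).
  - by move/(sep s st).
  - exact: config_inj.
pose E := config_of e_inj; have EE s : val E s = e s := config_ofE e_inj s.
have CE : puz k C E.
  apply/orP; left; apply/kmoveP; exists t, i; rewrite EE /e eqxx; split=> // s st.
  by rewrite EE /e (negPf st); case: (others s st).
apply: connect_trans (connect1 CE) (IHn E _ _).
  apply: leq_trans leCn; apply/proper_card/properP; split.
    apply/subsetP => s; rewrite !inE EE /e.
    by have [->|] := eqVneq s t; rewrite ?eqxx.
  by exists t; rewrite !inE // EE /e !eqxx.
move=> s; rewrite !EE /e; have [->|st DCs] := eqVneq s t; first by rewrite eqxx.
have [j Dsj others'] := movable s DCs; exists j => // u /others'[Cu Du].
by rewrite EE /e; split=> //; have [<-|] := eqVneq u t.
Qed.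

(** [None] stands for the vertex [a] and [Some i] for its neighbour [a + e_i]. *)
Definition star_vertex d (a : vertex d) (o : option 'I_d) : vertex d :=
  [ffun i => a i (+) (Some i == o)].

Lemma star_vertex_inj d (a : vertex d) : injective (star_vertex a).
Proof.
move=> o o' /ffunP eq_o; have {}eq_o i : (Some i == o) = (Some i == o').
  by have := eq_o i; rewrite !ffunE => /addbI.
case: o o' eq_o => [i|] [j|] // eq_o.
- by have := eq_o i; rewrite eqxx => /esym/eqP.
- by have := eq_o i; rewrite eqxx.
- by have := eq_o j; rewrite eqxx.
Qed.

Section UpperBound.

Variables (k l : nat).
Let T : finType := 'I_(2 ^ k.+1 - l).
Variables (place : T -> option 'I_k.+1) (z : T).
Hypotheses (place_inj : injective place) (place_z : place z = None).
Implicit Types (a : vertex k.+1) (p q : {perm T}) (x y : T).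

Fact star_subproof a p : injective (fun t => star_vertex a (place (p t))).
Proof. by move=> s t /star_vertex_inj/place_inj/perm_inj. Qed.

(** Token [t] plays the role [p t], with [z] the role of the centre; multiplying [p] on the right by
    a transposition exchanges two roles. *)
Definition star a p : config k.+1 l := config_of (@star_subproof a p).

Lemma starE a p t i : val (star a p) t i = a i (+) (Some i == place (p t)).
Proof. by rewrite config_ofE ffunE. Qed.

(** A leaf in a direction [i] other than [j] is the only token off the centre's value at [i], before
    and after the step, so all these leaves can cross in direction [j]. *)
Lemma star_step a p x :
  connect (@puz k.+1 k l) (star a p) (star (star_vertex a (place x)) (p * tperm z x)%g).
Proof.
have [->|xz] := eqVneq x z.
  rewrite tperm1 mulg1 place_z; have -> : star_vertex a None = a; last exact: connect0.
  by apply/ffunP => i; rewrite ffunE addbF.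
have z_only y : place y = None -> y = z by rewrite -place_z => /place_inj.
case placex: (place x) => [j|]; last by rewrite (z_only x) ?eqxx in xz.
apply: connect_disjoint_moves => t moved.
have [ptz ptx] : p t != z /\ p t != x.
  split; apply: contraNneq moved => pt; apply/eqP/ffunP => i;
    rewrite !starE permM pt ?tpermL ?tpermR ffunE placex place_z;
    by case: (Some i == Some j); case: (a i).
case placet: (place (p t)) => [i|]; last first.
  by rewrite (z_only (p t)) ?eqxx in ptz.
have ij : Some i != Some j.
  by rewrite -placet -placex (inj_eq place_inj).
exists i => [|s st].
  by rewrite !starE permM tpermD 1?eq_sym // ffunE (negPf ij) addbF placet.
rewrite !starE permM ffunE placet eqxx (negPf ij) addbF -placet !(inj_eq place_inj).
have tauE : p t = tperm z x (p t) by rewrite tpermD 1?eq_sym.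
by rewrite {2}tauE !(inj_eq perm_inj) (eq_sym t) (negPf st); case: (a i).
Qed.

Lemma star_step2 a p x y : x != z -> y != z ->
  connect (@puz k.+1 k l) (star a p) (star a (p * (tperm z x * tperm z y))%g).
Proof.
move=> xz yz; have [->|xy] := eqVneq x y; first by rewrite tperm2 mulg1 connect0.
(* Two steps would shift the centre; the braid relation rewrites the 3-cycle as a word using each
   letter twice, so the shifts cancel. *)
have -> : (tperm z x * tperm z y = tperm z y * tperm z x * tperm z y * tperm z x)%g.
  by rewrite -(tperm_braid xz yz xy) -mulgA tperm2 mulg1.
rewrite !mulgA.
have back : star_vertex (star_vertex (star_vertex (star_vertex a
    (place y)) (place x)) (place y)) (place x) = a.
  apply/ffunP => i; rewrite !ffunE.
  by case: (_ == place y); case: (_ == place x); case: (a i).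
rewrite -{2}back.
apply: connect_trans (star_step _ _ y) _; apply: connect_trans (star_step _ _ x) _.
by apply: connect_trans (star_step _ _ y) _; exact: star_step.
Qed.

(** An even permutation is a star word of even length, consumed two letters at a time. *)
Lemma star_even a p q : ~~ odd_perm q ->
  connect (@puz k.+1 k l) (star a p) (star a (p * q)%g).
Proof.
have [w wz ->] := perm_star_word z q; rewrite odd_star_word //.
have [n] := ubnP (size w); elim: n w p wz => // n IHn [|x [|y w]] //= p.
  by rewrite big_nil mulg1 connect0.
case/and3P=> xz yz wz szw; rewrite !negbK => evw.
apply: connect_trans (star_step2 a p xz yz) _.
rewrite !big_cons !mulgA -(mulgA p); apply: IHn => //.
by rewrite -ltnS; apply: ltnW.
Qed.

Lemma star_even_solvable : even_solvable k.+1 k l.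
Proof.
apply/existsP; exists (star [ffun=> false] 1%g).
apply/forallP => g; apply/implyP => g_even.
apply/forallP => D; apply/implyP => /forallP gD.
(* In [D], token [g t] stands where [t] stood, hence the inverse. *)
suff -> : D = star [ffun=> false] (1 * g^-1)%g by apply: star_even; rewrite odd_permV.
apply/val_inj/ffunP => t.
by rewrite -[in LHS](permKV g t) (eqP (gD _)) !config_ofE perm1 mul1g.
Qed.

End UpperBound.

(** [unlift ord0] sends token 0 to the centre and the other [k.+1] tokens to the leaves. *)
Lemma even_solvable_succ k l : 2 ^ k.+1 - l = k.+2 -> even_solvable k.+1 k l.
Proof.
move=> ntok; pose place (t : 'I_(2 ^ k.+1 - l)) := unlift ord0 (cast_ord ntok t).
have z_lt : 0 < 2 ^ k.+1 - l by rewrite ntok.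
apply: (@star_even_solvable k l place (Ordinal z_lt)).
- move=> s t; rewrite /place => eq_st; apply: (@cast_ord_inj _ _ ntok).
  by case: unliftP eq_st => [i ->|->]; case: unliftP => [j ->|->] // [->].
- by rewrite /place (_ : cast_ord _ _ = ord0) ?unlift_none //; apply: val_inj.
Qed.

(** * The exact minimum *)

Theorem theorem1p13 (k : nat) (hk : 1 <= k) :
  [/\ min_even_solvable k.+1 k = \sum_(1 <= i < k.+1) (2 ^ i - 1),
      \sum_(1 <= i < k.+1) (2 ^ i - 1) = 2 ^ k.+1 - k - 2 &
      exists2 l : nat, 2 ^ k.+1 - l = k + 2 & even_solvable k.+1 k l].
Proof.
(* Adding [n.+2] on the left avoids a truncated subtraction on the right. *)
have sumE n : \sum_(1 <= i < n.+1) (2 ^ i - 1) + n.+2 = 2 ^ n.+1.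
  elim: n => [|n IHn]; first by rewrite big_geq.
  rewrite big_nat_recr //= addnAC addnS IHn addSnnS subn1 prednK ?expn_gt0 //.
  by rewrite addnn -mul2n -expnS.
have le_k2 : k.+2 <= 2 ^ k.+1 by rewrite -(sumE k) leq_addl.
have {}sumE : \sum_(1 <= i < k.+1) (2 ^ i - 1) = 2 ^ k.+1 - k - 2.
  by rewrite -subnDA addn2 -(sumE k) addnK.
set L := 2 ^ k.+1 - k - 2 in sumE *; rewrite sumE.
(* By [hk] the sum contains the positive term [i = 1]. *)
have L_gt0 : 0 < L.
  by rewrite -sumE big_ltn // addn_gt0.
have ntok : 2 ^ k.+1 - L = k.+2.
  by rewrite /L -subnDA addn2 subKn.
split=> //; last by exists L; [rewrite addn2|exact: even_solvable_succ].
rewrite /min_even_solvable; case: ex_minnP => m /andP[/andP[m_gt0 m_le] m_sol] m_min.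
apply/eqP; rewrite eqn_leq m_min ?L_gt0 ?even_solvable_succ //=; last first.
  by rewrite andbT /L -subnDA leq_subr.
(* Fewer than [L] empty vertices leave at least [k.+3] tokens. *)
rewrite leqNgt; apply: contraL m_sol => ltmL; apply: not_even_solvable.
by rewrite -ntok ltn_sub2l // (leq_trans ltmL) // /L -subnDA leq_subr.
Qed.
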